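(* Let $n\ge 2$ and let $B_n$ be the group of signed permutations of $[\pm n]$ (bijections $w$ of $\{-n,\dots,-1,1,\dots,n\}$ with $w(-a)=-w(a)$). Define $f^B_0$ by $f^B_0(1)=-1$, $f^B_0(m)=m$ for $2\le m\le n$, and for $1\le i\le n-1$ define $f^B_i$ by $f^B_i(m)=-(i+2-m)$ for $1\le m\le i+1$ and $f^B_i(m)=m$ for $i+1<m\le n$. The burnt pancake graph of $B_n$ is the Cayley graph with vertex set $B_n$ in which $w$ and $wf^B_i$ are joined by an edge labelled $f^B_i$, for each $w\in B_n$ and $0\le i\le n-1$. Let $0\le i<j<n$, let $k$ be the order of $f^B_if^B_j$ in $B_n$, and let $\ell=2k$. Then the burnt pancake graph of $B_n$ contains a maximal set of $\frac{2^n n!}{\ell}$ independent (pairwise vertex-disjoint) $\ell$-cycles of the form $(f^B_if^B_j)^k$, i.e. cycles $w,\ wf^B_i,\ wf^B_if^B_j,\ wf^B_if^B_jf^B_i,\ \dots$ whose successive edges are alternately labelled $f^B_i$ and $f^B_j$.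
   Context: Signed permutations are composed as functions. *)

(* Defs.v *)
From HB Require Import structures.
From mathcomp Require Import all_boot all_order all_algebra all_fingroup.
From mathcomp Require Import zify.
Set Implicit Arguments.
Unset Strict Implicit.
Unset Printing Implicit Defensive.
Import Order.TTheory GRing.Theory Num.Theory.
Local Open Scope ring_scope.

(* The set [+-n] = {-n, ..., -1, 1, ..., n}. *)
Record pmint (n : nat) := PMInt {
  pmval :> int;
  pmvalP : (pmval != 0) && (`|pmval|%N <= n)%N }.

HB.instance Definition _ n := [isSub for @pmval n].
HB.instance Definition _ n := [Choice of pmint n by <:].

Section PMFinite.
Variable n : nat.

Definition pm_code (a : pmint n) : bool * 'I_n.+1 :=
  (pmval a < 0, inord `|pmval a|%N).
Definition pm_decode (p : bool * 'I_n.+1) : option (pmint n) :=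
  insub (if p.1 then - (p.2 : nat)%:Z else (p.2 : nat)%:Z).

Lemma pm_codeK : pcancel pm_code pm_decode.
Proof.
move=> a; rewrite /pm_decode /pm_code /=.
have /andP[a0 an] := pmvalP a.
rewrite inordK ?ltnS //.
have -> : (if pmval a < 0 then - (`|pmval a|%N)%:Z else (`|pmval a|%N)%:Z)
  = pmval a by case: ifP; lia.
exact: valK.
Qed.

HB.instance Definition _ := PCanIsCountable pm_codeK.
HB.instance Definition _ : isFinite (pmint n) := PCanIsFinite pm_codeK.

Lemma pmopp_subproof (a : pmint n) :
  (- pmval a != 0) && (`|- pmval a|%N <= n)%N.
Proof. by rewrite oppr_eq0 abszN; exact: pmvalP. Qed.

Definition pmopp (a : pmint n) : pmint n := PMInt (pmopp_subproof a).

End PMFinite.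

Record signedPerm (n : nat) := SignedPerm {
  sperm :> {perm pmint n};
  spermP : [forall a, sperm (pmopp a) == pmopp (sperm a)] }.

HB.instance Definition _ n := [isSub for @sperm n].
HB.instance Definition _ n := [Finite of signedPerm n by <:].

Section SignedPermGroup.
Variable n : nat.
Implicit Types u v w : signedPerm n.

Lemma spermN w a : w (pmopp a) = pmopp (w a).
Proof. by have /forallP/(_ a)/eqP := spermP w. Qed.

Lemma sperm_one_subproof :
  [forall a, (1%g : {perm pmint n}) (pmopp a) == pmopp ((1%g : {perm _}) a)].
Proof. by apply/forallP => a; rewrite !perm1. Qed.

(* The product of {perm T} composes from left to right, (s * t) x = t (s x),
   hence the swap in sperm_mul; see spermM. *)
Lemma sperm_mul_subproof u v :
  [forall a, (sperm v * sperm u)%g (pmopp a)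
             == pmopp ((sperm v * sperm u)%g a)].
Proof. by apply/forallP => a; rewrite !permM !spermN. Qed.

Lemma sperm_inv_subproof u :
  [forall a, (sperm u)^-1%g (pmopp a) == pmopp ((sperm u)^-1%g a)].
Proof.
by apply/forallP => a; apply/eqP/(@perm_inj _ (sperm u)); rewrite spermN !permKV.
Qed.

Definition sperm_one : signedPerm n := SignedPerm sperm_one_subproof.
Definition sperm_mul u v : signedPerm n := SignedPerm (sperm_mul_subproof u v).
Definition sperm_inv u : signedPerm n := SignedPerm (sperm_inv_subproof u).

Lemma sperm_mulA : associative sperm_mul.
Proof. by move=> u v w; apply/val_inj; rewrite /= mulgA. Qed.
Lemma sperm_mul1 : left_id sperm_one sperm_mul.
Proof. by move=> u; apply/val_inj; rewrite /= mulg1. Qed.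
Lemma sperm_mulV : left_inverse sperm_one sperm_inv sperm_mul.
Proof. by move=> u; apply/val_inj; rewrite /= mulgV. Qed.

HB.instance Definition _ :=
  Finite_isGroup.Build (signedPerm n) sperm_mulA sperm_mul1 sperm_mulV.

Lemma spermM u v a : (u * v)%g a = u (v a).
Proof. by rewrite permM. Qed.

End SignedPermGroup.

(* The value of f^B_i at a positive integer m. *)
Definition flip_pos (i : nat) (m : int) : int :=
  if i == 0%N then (if m == 1 then -1 else m)
  else if m <= i.+1%:Z then - (i.+2%:Z - m) else m.

Definition flipz (i : nat) (x : int) : int :=
  if 0 < x then flip_pos i x else - flip_pos i (- x).

Lemma flip_posE (i : nat) (m : int) : 0 < m ->
  flip_pos i m = if m <= i.+1%:Z then - (i.+2%:Z - m) else m.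
Proof. by move=> m0; rewrite /flip_pos; case: i => [|i] //=; do 2!case: ifP; lia. Qed.

Lemma flipzE (i : nat) (x : int) : x != 0 ->
  flipz i x = if (`|x|%N <= i.+1)%N
              then (if 0 < x then x - i.+2%:Z else x + i.+2%:Z) else x.
Proof.
move=> x0; rewrite /flipz; case: (ltrP 0 x) => hx; rewrite flip_posE; try lia.
  by do ![case: ifP]; lia.
by do ![case: ifP]; lia.
Qed.

Section Flip.
Variables (n : nat) (i : 'I_n).

Lemma flip_subproof (a : pmint n) :
  (flipz i (pmval a) != 0) && (`|flipz i (pmval a)|%N <= n)%N.
Proof.
have /andP[a0 an] := pmvalP a; have := ltn_ord i; rewrite /flipz.
by case: ifP => ha; rewrite flip_posE; try lia; case: ifP; lia.
Qed.

Definition flip_fun (a : pmint n) : pmint n := PMInt (flip_subproof a).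

Lemma flip_funK : involutive flip_fun.
Proof.
move=> a; apply/val_inj => /=; have /andP[a0 _] := pmvalP a.
have b0 : flipz i (pmval a) != 0 by have /andP[] := flip_subproof a.
rewrite (flipzE i b0) (flipzE i a0).
by do ![case: ifP]; lia.
Qed.

Lemma flip_subproofN :
  [forall a, perm (inv_inj flip_funK) (pmopp a)
             == pmopp (perm (inv_inj flip_funK) a)].
Proof.
apply/forallP => a; apply/eqP/val_inj; rewrite !permE /= /flipz.
have /andP[a0 _] := pmvalP a.
by case: (ltrP 0 (pmval a)) => ha; [rewrite ifF | rewrite ifT]; rewrite ?opprK //; lia.
Qed.

Definition fB : signedPerm n := SignedPerm flip_subproofN.

Lemma fB_val (a : pmint n) : 0 < pmval a -> pmval (fB a) = flip_pos i (pmval a).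
Proof. by move=> ha; rewrite permE /= /flipz ha. Qed.

End Flip.

Section BurntPancakeGraph.
Variable n : nat.
Implicit Types (i j : 'I_n) (v w : signedPerm n) (c : seq (signedPerm n)).

Definition bp_edge_lab i : rel (signedPerm n) :=
  fun w v => (v == (w * fB i)%g) || (w == (v * fB i)%g).

Definition bp_edge : rel (signedPerm n) :=
  fun w v => [exists i, bp_edge_lab i w v].

Definition bp_cycle c : bool := (2 < size c)%N && ucycleb bp_edge c.

(* The edges c_0 c_1, c_1 c_2, ..., including the closing edge from the last
   vertex to c_0, are labelled f^B_i, f^B_j, f^B_i, ... *)
Definition alternating i j c : bool :=
  [forall t : 'I_(size c),
     bp_edge_lab (if odd t then j else i)
       (nth 1%g c t) (nth 1%g c (t.+1 %% size c))].

(* Cycles are given by their vertex sequences.  Distinct members of C have no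
   common vertex, so C never contains two traversals of the same cycle and
   #|C| is the number of cycles. *)
Definition indep_alt_cycles i j (l : nat)
    (C : {set l.-tuple (signedPerm n)}) : bool :=
  [forall c in C, bp_cycle c && alternating i j c] &&
  [forall c in C, forall d in C, (c != d) ==> [disjoint c & d]].

End BurntPancakeGraph.

(* Main.v *)
(** Write [a], [b] for the two flips.  They are distinct involutions, so
    [<a, b>] is dihedral of order [l = 2k], and the walk from [w] with labels
    alternately [a] and [b] visits each element of the left coset [w <a, b>]
    exactly once.  One such cycle per coset partitions the vertex set, which
    has [2 ^ n * n`!] elements; no independent family of [l]-cycles can be
    larger. *)
Require Import Defs.
From mathcomp Require Import all_boot all_order all_algebra all_fingroup.
From mathcomp Require Import cyclic zify.

Set Implicit Arguments.
Unset Strict Implicit.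
Unset Printing Implicit Defensive.

(** Indexing modulo the size absorbs the closing edge, which puts [path.cycle] in the same form as
    [alternating]. *)
Lemma cycle_nthP (T : eqType) (e : rel T) (x0 : T) (c : seq T) :
  reflect (forall t, t < size c -> e (nth x0 c t) (nth x0 c (t.+1 %% size c)))
          (path.cycle e c).
Proof.
case: c => [|x p] /=; first by left.
apply: (iffP (pathP x0)) => h t; rewrite ?size_rcons => lt_t.
  have := h t; rewrite size_rcons -rcons_cons !nth_rcons /= lt_t => /(_ isT).
  have [lt_tp|le_pt] := ltnP t (size p); first by rewrite modn_small.
  have -> : t = size p by apply/eqP; rewrite eqn_leq le_pt -ltnS lt_t.
  by rewrite eqxx modnn.
have := h t lt_t; rewrite -rcons_cons !nth_rcons /= lt_t.
have [lt_tp|le_pt] := ltnP t (size p); first by rewrite modn_small.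
have -> : t = size p by apply/eqP; rewrite eqn_leq le_pt -ltnS lt_t.
by rewrite eqxx modnn.
Qed.

(** * The order of the group of signed permutations *)

Section SignedPermCard.
Variable n : nat.

Definition pmneg (a : pmint n) : bool := (pmval a < 0)%R.

Lemma pmabs_subproof (a : pmint n) : (absz (pmval a)).-1 < n.
Proof. by have /andP[] := pmvalP a; lia. Qed.

(* ['I_n] starts at [0]: the index [m] stands for the absolute value [m.+1]. *)
Definition pmabs (a : pmint n) : 'I_n := Ordinal (pmabs_subproof a).

Definition signz (b : bool) (m : nat) : int := if b then Negz m else Posz m.+1.

Lemma pmmk_subproof (b : bool) (m : 'I_n) :
  (signz b m != 0)%R && (absz (signz b m) <= n).
Proof. by have := ltn_ord m; case: b => /=; lia. Qed.

Definition pmmk (b : bool) (m : 'I_n) : pmint n := PMInt (pmmk_subproof b m).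

Lemma pmmkK a : pmmk (pmneg a) (pmabs a) = a.
Proof.
apply/val_inj; have /andP[] := pmvalP a.
by rewrite /= /signz /pmneg; case: ifP; lia.
Qed.

Lemma pmneg_mk b m : pmneg (pmmk b m) = b.
Proof. by case: b. Qed.

Lemma pmabs_mk b m : pmabs (pmmk b m) = m.
Proof. by apply/val_inj; case: b. Qed.

Lemma pmopp_mk b m : pmopp (pmmk b m) = pmmk (~~ b) m.
Proof. by apply/val_inj; case: b. Qed.

Lemma pmnegN a : pmneg (pmopp a) = ~~ pmneg a.
Proof. by rewrite -(pmmkK a) pmopp_mk !pmneg_mk. Qed.

Lemma pmabsN a : pmabs (pmopp a) = pmabs a.
Proof. by rewrite -(pmmkK a) pmopp_mk !pmabs_mk. Qed.

Definition sgn_of (w : signedPerm n) : {ffun 'I_n -> bool} :=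
  [ffun m => pmneg (w (pmmk false m))].

(** Images with the same absolute value are equal or opposite. As [w] is injective and odd, so are
    the points, and both points are positive. *)
Lemma abs_of_inj (w : signedPerm n) :
  injective (fun m => pmabs (w (pmmk false m))).
Proof.
move=> m1 m2 /= e.
have [e'|ne] := eqVneq (pmneg (w (pmmk false m1))) (pmneg (w (pmmk false m2))).
  have /perm_inj : w (pmmk false m1) = w (pmmk false m2).
    by rewrite -[LHS]pmmkK e e' pmmkK.
  by move/(congr1 pmabs); rewrite !pmabs_mk.
have /perm_inj : w (pmmk false m1) = w (pmopp (pmmk false m2)).
  rewrite spermN -[LHS]pmmkK -[RHS]pmmkK pmabsN pmnegN e; congr pmmk.
  by move: ne; do 2!case: pmneg.
by move/(congr1 pmabs); rewrite pmabsN !pmabs_mk.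
Qed.

Definition abs_of (w : signedPerm n) : {perm 'I_n} := perm (@abs_of_inj w).

Definition signed_fun (e : {ffun 'I_n -> bool}) (s : {perm 'I_n})
  (a : pmint n) := pmmk (pmneg a (+) e (pmabs a)) (s (pmabs a)).

Lemma signed_fun_inj e s : injective (signed_fun e s).
Proof.
move=> a b E.
have eq_abs : pmabs a = pmabs b.
  by move/(congr1 pmabs): E; rewrite !pmabs_mk => /perm_inj.
move/(congr1 pmneg): E; rewrite !pmneg_mk eq_abs => /addIb eq_neg.
by rewrite -(pmmkK a) -(pmmkK b) eq_abs eq_neg.
Qed.

Lemma signed_fun_subproof e s :
  [forall a, perm (@signed_fun_inj e s) (pmopp a)
             == pmopp (perm (@signed_fun_inj e s) a)].
Proof.
apply/forallP => a; rewrite !permE /signed_fun pmopp_mk pmabsN pmnegN.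
by rewrite addNb.
Qed.

Definition signed_of (p : {ffun 'I_n -> bool} * {perm 'I_n}) : signedPerm n :=
  SignedPerm (signed_fun_subproof p.1 p.2).

Lemma signed_ofK : cancel signed_of (fun w => (sgn_of w, abs_of w)).
Proof.
case=> e s; congr pair.
  apply/ffunP=> m; rewrite ffunE permE /= /signed_fun.
  by rewrite pmneg_mk pmneg_mk pmabs_mk.
by apply/permP=> m; rewrite !permE /= !pmabs_mk.
Qed.

Lemma sgn_abs_ofK : cancel (fun w => (sgn_of w, abs_of w)) signed_of.
Proof.
move=> w; apply/val_inj/permP => a.
rewrite permE /signed_fun /= ffunE permE.
(* Signs and absolute values are recorded at positive points only; a negative point is reached by
   oddness of [w]. *)
rewrite -[in RHS](pmmkK a); case: (pmneg a) => /=; last by rewrite pmmkK.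
by rewrite -pmopp_mk pmmkK -spermN pmopp_mk.
Qed.

Lemma card_signedPerm : #|{: signedPerm n}| = 2 ^ n * n`!.
Proof.
rewrite -(bij_eq_card (Bijective signed_ofK sgn_abs_ofK)) card_prod.
by rewrite card_ffun card_bool card_ord card_Sn.
Qed.

End SignedPermCard.

(** * Two distinct involutions and their dihedral group *)

Section AlternatingWords.
Variables (gT : finGroupType) (a b : gT).
Hypotheses (aa : (a * a = 1)%g) (bb : (b * b = 1)%g) (a1 : a != 1%g)
  (b1 : b != 1%g) (neq_ab : a != b).
Local Open Scope group_scope.

Let r := a * b.
Let l := (2 * #[r])%N.

(* The product [a * b * a * ...] of the first [t] letters. *)
Definition altword (t : nat) : gT := r ^+ t./2 * a ^+ odd t.

Lemma altwordS t : altword t.+1 = altword t * (if odd t then b else a).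
Proof.
rewrite /altword /= uphalf_half; case: (odd t) => /=; rewrite ?mulg1 //.
by rewrite addnC addn1 expgSr expg1 -mulgA.
Qed.

Lemma altword_order : altword l = 1.
Proof. by rewrite /altword /l mul2n odd_double doubleK expg_order mulg1. Qed.

Lemma invol_inv : a^-1 = a.
Proof. by apply/eqP; rewrite eq_invg_mul aa. Qed.

Lemma order_invol : #[a] = 2.
Proof. by apply: nt_prime_order => //; rewrite expgS expg1. Qed.

(** Conjugating by [a] turns [a * b] into [b * a], the inverse of [r] because both letters are
    involutions. *)
Lemma invol_conj_rot : r ^ a = r^-1.
Proof.
rewrite /conjg /r invMg invol_inv !mulgA aa mul1g; congr (_ * _).
by apply/eqP; rewrite eq_sym eq_invg_mul bb.
Qed.

Lemma rot_neq1 : r != 1.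
Proof. by rewrite -eq_invg_mul invol_inv. Qed.

Lemma order_rot_gt1 : (1 < #[r])%N.
Proof. by rewrite order_gt1 rot_neq1. Qed.

(* If [a] were a power of [r] then [r ^ a] would be both [r] and [r^-1], so
   [<[r]>] would have order 2 and [a = r], i.e., [b = 1]. *)
Lemma invol_notin_rot : a \notin <[r]>.
Proof.
apply/negP => ar.
have cra : r ^ a = r.
  have /centsP/(_ r (cycle_id r) a ar) := cycle_abelian r.
  by move=> c; rewrite /conjg c mulKg.
have rr : r ^+ 2 = 1.
  by rewrite expgS expg1 -{1}cra invol_conj_rot mulVg.
have o2 : #[r] = 2 by apply: nt_prime_order => //; exact: rot_neq1.
move: ar => /cycleP[m]; rewrite -(expg_mod_order r m) o2 modn2.
case: (odd m) => /= e; last by move: a1; rewrite e eqxx.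
by move: b1; rewrite -(inj_eq (mulgI a)) mulg1 {2}e expg1 eqxx.
Qed.

(** Words of even length are powers of [r], and words of odd length lie in the other coset [<[r]>
    a]. Within one parity the exponent is below [#[r]], so it is determined. *)
Lemma altword_inj : {in gtn l &, injective altword}.
Proof.
move=> s t; rewrite !inE /l => ls lt E.
have lh u : (u < 2 * #[r])%N -> (u./2 < #[r])%N by lia.
have [eo|no] := eqVneq (odd s) (odd t).
  move: E; rewrite /altword eo => /mulIg /eqP.
  rewrite eq_expg_mod_order !modn_small ?lh // => /eqP eh.
  by rewrite -(odd_double_half s) -(odd_double_half t) eo eh.
(* For lengths of different parity the equation is absurd: it would put [a] in [<[r]>]. *)
have aP u v : r ^+ u = r ^+ v * a -> s = t.
  move=> e; case/negP: invol_notin_rot.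
  have -> : a = (r ^+ v)^-1 * r ^+ u by rewrite e mulKg.
  by rewrite groupM ?groupV ?mem_cycle.
move: E no; rewrite /altword; case: (odd s); case: (odd t) => //=.
  by rewrite expg1 mulg1 => /esym/aP.
by rewrite expg1 mulg1 => /aP.
Qed.

(** This is the group generated by [a] and [b]; separating the rotations from one reflection makes
    its order computable. *)
Definition altgroup : {group gT} := (<[r]> <*> <[a]>)%G.

Lemma altword_group t : altword t \in altgroup.
Proof.
apply: groupM; apply: groupX; apply: mem_gen; rewrite !inE cycle_id ?orbT //.
Qed.

(** The subgroup [<[a]>], of order 2, normalises [<[r]>] and meets it trivially, so the orders
    multiply. *)
Lemma card_altgroup : #|altgroup| = l.
Proof.
have nra : <[a]> \subset 'N(<[r]>).
  by rewrite cycle_subG; apply/normP; rewrite -cycleJ invol_conj_rot cycleV.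
rewrite /= norm_joinEr // TI_cardMg; last first.
  apply/trivgP/subsetP => x; rewrite !inE => /andP[xr /cycleP[m xE]].
  move: xr; rewrite {}xE -(expg_mod_order a m) order_invol modn2.
  by case: (odd m) => /=; rewrite ?eqxx // expg1 (negPf invol_notin_rot).
by rewrite -!orderE order_invol mulnC.
Qed.

End AlternatingWords.

(** * The flips are distinct nontrivial involutions *)

Section Flips.
Variable n : nat.
Local Open Scope group_scope.

Lemma fB_sq (i : 'I_n) : fB i * fB i = 1.
Proof.
by apply/val_inj/permP => a; rewrite spermM /= !permE flip_funK.
Qed.

Lemma one_subproof (i : 'I_n) : (Posz 1 != 0)%R && (absz 1 <= n)%N.
Proof. by have := ltn_ord i; lia. Qed.

(** The image of 1 is $-(i+1)$, so this single point separates the flips from the identity and from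
    each other. *)
Lemma fB_one (i : 'I_n) (a : pmint n) :
  pmval a = Posz 1 -> pmval (fB i a) = Negz i.
Proof. by move=> a1; rewrite fB_val a1 // flip_posE //=; lia. Qed.

Lemma fB_neq1 (i : 'I_n) : fB i != 1.
Proof.
apply/eqP => e; have := fB_one i (erefl : pmval (PMInt (one_subproof i)) = _).
by rewrite e /= perm1.
Qed.

Lemma fB_inj : injective (@fB n).
Proof.
move=> i j e; have := fB_one i (erefl : pmval (PMInt (one_subproof i)) = _).
by rewrite e fB_one // => -[] /val_inj.
Qed.

End Flips.

(** * Alternating cycles, one for each left coset *)

Section AlternatingCycles.
Variables (n : nat) (i j : 'I_n).
Hypothesis neq_ij : i != j.
Local Open Scope group_scope.

Let k := #[fB i * fB j].
Let l := (2 * k)%N.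
Let H := altgroup (fB i) (fB j).

Lemma fB_neq : fB i != fB j.
Proof. by rewrite (inj_eq (@fB_inj n)). Qed.

Lemma alt_length_gt2 : (2 < l)%N.
Proof. by have := order_rot_gt1 (fB_sq i) fB_neq; rewrite -/k /l; lia. Qed.

Definition altcycle (w : signedPerm n) : l.-tuple (signedPerm n) :=
  [tuple w * altword (fB i) (fB j) t | t < l].

Lemma size_altcycle w : size (altcycle w) = l.
Proof. exact: size_tuple. Qed.

Lemma nth_altcycle w t : (t < l)%N ->
  nth 1 (altcycle w) t = w * altword (fB i) (fB j) t.
Proof. by move=> lt; rewrite -(tnth_nth _ _ (Ordinal lt)) tnth_mktuple. Qed.

Lemma altcycle_lcoset w v : v \in altcycle w -> v \in w *: H.
Proof.
by case/tnthP=> t ->; rewrite tnth_mktuple mem_lcoset mulKg altword_group.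
Qed.

Lemma altcycle_inj : injective altcycle.
Proof.
(* The entry at index 0 recovers the base vertex. *)
move=> w v /(congr1 (fun c : l.-tuple _ => nth 1 c 0)) /=.
have l0 : (0 < l)%N by apply: ltn_trans alt_length_gt2.
by rewrite !nth_altcycle // => /mulIg.
Qed.

Lemma alternating_altcycle w : alternating i j (altcycle w).
Proof.
apply/forallP => -[t /=]; rewrite size_altcycle => lt.
have l0 : (0 < l)%N by exact: leq_ltn_trans (leq0n t) lt.
rewrite nth_altcycle // nth_altcycle ?ltn_mod // /bp_edge_lab.
apply/orP; left; rewrite -mulgA (inj_eq (mulgI w)).
have -> : fB (if odd t then j else i) = if odd t then fB j else fB i.
  by case: ifP.
(* At the last index the next position wraps to 0, and the walk closes because the word of length
   [l] is trivial. *)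
rewrite -altwordS; move: lt; rewrite leq_eqVlt => /predU1P[e|lt].
  by rewrite e modnn altword_order /altword !expg0 mulg1.
by rewrite modn_small.
Qed.

Lemma bp_cycle_altcycle w : bp_cycle (altcycle w).
Proof.
rewrite /bp_cycle size_altcycle alt_length_gt2 /=; apply/andP; split.
  apply/(cycle_nthP _ 1) => t lt; apply/existsP.
  exists (if odd t then j else i).
  exact: (forallP (alternating_altcycle w) (Ordinal lt)).
apply/(uniqP 1) => s t; rewrite !inE size_altcycle => ls lt.
rewrite !nth_altcycle // => /mulgI.
by apply: (altword_inj (fB_sq i) (fB_sq j) (fB_neq1 i) (fB_neq1 j) fB_neq).
Qed.

Definition altcycles : {set l.-tuple (signedPerm n)} :=
  [set altcycle (repr A) | A : {set signedPerm n} in lcosets H [set: signedPerm n]].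

Lemma repr_lcosets (A : {set signedPerm n}) :
  A \in lcosets H [set: signedPerm n] -> A = repr A *: H.
Proof.
case/lcosetsP=> x _ ->; apply/esym/lcoset_eqP.
by apply: (mem_repr x); rewrite lcoset_refl.
Qed.

(** A vertex shared by two cycles would lie in both of their cosets, forcing these to coincide, and
    hence the chosen representatives. *)
Lemma indep_altcycles : indep_alt_cycles i j altcycles.
Proof.
apply/andP; split.
  apply/forall_inP => c /imsetP[A _ ->].
  by rewrite bp_cycle_altcycle alternating_altcycle.
apply/forall_inP => c /imsetP[A hA ->].
apply/forall_inP => d /imsetP[B hB ->].
apply/implyP => ne; rewrite disjoint_subset; apply/subsetP => v.
move=> /altcycle_lcoset; rewrite -repr_lcosets // => vA.
rewrite !inE; apply: contra ne => /altcycle_lcoset.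
rewrite -repr_lcosets // => vB; apply/eqP; congr (altcycle (repr _)).
move: vA vB; rewrite (repr_lcosets hA) (repr_lcosets hB).
by move=> /lcoset_eqP <- /lcoset_eqP <-.
Qed.

Lemma card_altcycles : (#|altcycles| * l = 2 ^ n * n`!)%N.
Proof.
rewrite card_in_imset; last first.
  move=> A B hA hB /altcycle_inj e.
  by rewrite (repr_lcosets hA) e -repr_lcosets.
rewrite card_lcosets mulnC /l /k.
rewrite -(card_altgroup (fB_sq i) (fB_sq j) (fB_neq1 i) (fB_neq1 j) fB_neq).
by rewrite Lagrange ?subsetT // cardsT card_signedPerm.
Qed.

End AlternatingCycles.

(** * The upper bound and the conclusion *)

Lemma card_indep_alt_cycles (n : nat) (i j : 'I_n) (l : nat)
    (D : {set l.-tuple (signedPerm n)}) :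
  indep_alt_cycles i j D -> #|D| * l <= 2 ^ n * n`!.
Proof.
case/andP=> /forall_inP hc /forall_inP hd.
(* A vertex determines its cycle by disjointness, then its position by uniqueness, so [D] covers
   [#|D| * l] vertices. *)
have tnthI : {in setX D [set: 'I_l] &, injective (fun p => tnth p.1 p.2)}.
  move=> [c s] [d t] /setXP[cD _] /setXP[dD _] /= e.
  have ecd : c = d.
    apply/eqP/negPn/negP => ne.
    have /disjointFr/(_ (mem_tnth s c)) : [disjoint c & d].
      exact: implyP (forall_inP (hd c cD) d dD) ne.
    by rewrite e mem_tnth.
  have /andP[/and3P[_ _ /tuple_uniqP uc] _] := hc c cD.
  by rewrite ecd in e uc *; rewrite (uc _ _ e).
have := max_card [in (fun p : l.-tuple _ * 'I_l => tnth p.1 p.2)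
                     @: setX D [set: 'I_l]].
by rewrite card_in_imset // cardsX cardsT card_ord card_signedPerm.
Qed.

Theorem theorem4p3 (n : nat) (hn : 2 <= n) (i j : 'I_n) (hij : i < j)
    (k l : nat) (hk : k = #[(fB i * fB j)%g]%g) (hl : l = 2 * k) :
  exists C : {set l.-tuple (signedPerm n)},
    [/\ maxset (@indep_alt_cycles n i j l) C,
        (forall D : {set l.-tuple (signedPerm n)},
           indep_alt_cycles i j D -> #|D| <= #|C|),
        l %| 2 ^ n * n`!
      & #|C| = (2 ^ n * n`!) %/ l].
Proof.
subst l k.
have neq_ij : i != j by apply: contraTneq hij => ->; rewrite ltnn.
have l0 : 0 < 2 * #[(fB i * fB j)%g]%g.
  by apply: ltn_trans (alt_length_gt2 neq_ij).
have cardC := card_altcycles neq_ij.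
have maxC (D : {set (2 * #[(fB i * fB j)%g]%g).-tuple (signedPerm n)}) :
    indep_alt_cycles i j D -> #|D| <= #|altcycles i j|.
  by move/card_indep_alt_cycles; rewrite -cardC leq_pmul2r.
exists (altcycles i j); split => //.
(* Maximality for inclusion follows from maximal cardinality: an independent superset cannot be
   larger, so it is equal. *)
- apply/maxsetP; split; first exact: indep_altcycles.
  by move=> D /maxC cD sD; apply/esym/eqP; rewrite eqEcard sD.
- by rewrite -cardC dvdn_mull.
- by rewrite -cardC mulnK.
Qed.
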